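(* Let $\Gamma$ be a group and $\Lambda\subset\Gamma$ a subgroup with the following property: for every positive integer $n$ there are $n$ conjugate embeddings $\Lambda_1,\ldots,\Lambda_n\subset\Gamma$ of $\Lambda$ in $\Gamma$ (i.e. there are $g_1,\ldots,g_n\in\Gamma$ with $\Lambda_i=g_i\Lambda g_i^{-1}$, the embedding being $x\mapsto g_ixg_i^{-1}$) such that every element of $\Lambda_i$ commutes in $\Gamma$ with every element of $\Lambda_j$ whenever $i\neq j$. Then for every homogeneous quasi-homomorphism $\varphi\colon\Gamma\rightarrow\mathbb{R}$ the restriction $\varphi|_\Lambda\colon\Lambda\rightarrow\mathbb{R}$ is a homomorphism.
   Context: A map $f\colon\Gamma\rightarrow\mathbb{R}$ on a group $\Gamma$ is a quasi-homomorphism if there is a constant $D$ such that $|f(xy)-f(x)-f(y)|\leq D$ for all $x,y\in\Gamma$. It is homogeneous if $f(g^n)=nf(g)$ for all $g\in\Gamma$ and all $n\in\mathbb{Z}$. *)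

(* Defs.v *)
From HB Require Import structures.
From mathcomp Require Import all_boot all_order all_algebra.
From mathcomp Require Import all_classical all_reals.

Set Implicit Arguments.
Unset Strict Implicit.
Unset Printing Implicit Defensive.

Import Order.TTheory GRing.Theory Num.Theory.

Local Open Scope classical_set_scope.
Local Open Scope ring_scope.

(* [groupType] covers arbitrary, possibly infinite, groups, but MathComp only
   provides natural-number powers in it; [Negz n] is the integer - n.+1. *)
Definition expgz (G : groupType) (x : G) (m : int) : G :=
  match m with
  | Posz n => (x ^+ n)%g
  | Negz n => (x ^- n.+1)%g
  end.

Definition quasi_homomorphism (R : realType) (G : groupType) (f : G -> R) :=
  exists D : R, forall x y : G, `|f (x * y)%g - f x - f y| <= D.

Definition homogeneous (R : realType) (G : groupType) (f : G -> R) :=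
  forall (x : G) (m : int), f (expgz x m) = m%:~R * f x.

(* MathComp's [x ^ g] is g^-1 x g, hence the explicit product. *)
Definition conj_subset (G : groupType) (g : G) (L : set G) : set G :=
  [set (g * x * g^-1)%g | x in L].

(* Only the conjugating elements are indexed: the subsets g_i L g_i^-1 need
   not be pairwise distinct. *)
Definition has_commuting_conjugates (G : groupType) (L : set G) (n : nat) :=
  exists g : 'I_n -> G, forall i j : 'I_n, i != j ->
    forall x y : G, conj_subset (g i) L x -> conj_subset (g j) L y ->
      commute x y.

(* Main.v *)
Require Import Defs.
From HB Require Import structures.
From mathcomp Require Import all_boot all_order all_algebra.
From mathcomp Require Import all_classical all_reals.
From mathcomp Require Import ring.

Set Implicit Arguments.
Unset Strict Implicit.
Unset Printing Implicit Defensive.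

Import Order.TTheory GRing.Theory Num.Theory.

Local Open Scope classical_set_scope.
Local Open Scope ring_scope.

(** Every step is an amplification: a real number vanishes as soon as all its
    positive multiples are bounded by one constant ([bounded_multiples_eq0]).

    Applied to powers, which [phi] turns into multiples, this shows that a
    homogeneous quasi-homomorphism is additive on commuting elements
    ([homogeneous_commuteM]) and invariant under conjugation
    ([homogeneous_conj]).

    For [x] and [y] in [L], write [x_i] and [y_i] for their conjugates by
    [g_i], where [g_1, ..., g_n] conjugate [L] to pairwise commuting subgroups.
    The elements with distinct indices commute, so the product of the
    [x_i y_i] is [X Y], where [X] is the product of the [x_i] and [Y] that of
    the [y_i].  By the two facts above, [phi (X Y) - phi X - phi Y] is [n] times
    the defect [phi (x y) - phi x - phi y].  It is bounded by the constant of
    [phi], which does not depend on [n]; hence the defect is zero. *)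

Lemma bounded_multiples_eq0 (R : archiRealFieldType) (d C : R) :
  (forall n, (0 < n)%N -> `|n%:R * d| <= C) -> d = 0.
Proof.
move=> bounded; apply/eqP; apply: contraT; rewrite -normr_gt0 => d_gt0.
have C_ge0 : 0 <= C by apply: le_trans (bounded 1%N isT).
have := archi_boundP (divr_ge0 C_ge0 (ltW d_gt0)).
set n := Num.bound _ => ltCn.
have := bounded n.+1 isT.
by rewrite leNgt normrM normr_nat -ltr_pdivrMr // (lt_trans ltCn) // ltr_nat.
Qed.

Lemma homogeneousX (R : realType) (G : groupType) (phi : G -> R) x n :
  homogeneous phi -> phi (x ^+ n)%g = n%:R * phi x.
Proof. by move=> phi_homog; exact: (phi_homog x n%:Z). Qed.

Lemma homogeneous1 (R : realType) (G : groupType) (phi : G -> R) :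
  homogeneous phi -> phi 1%g = 0.
Proof. by move/(homogeneousX 1%g 0); rewrite mul0r. Qed.

(** For commuting elements [(x y)^n = x^n y^n], so the [n]-fold multiple of the
    defect at [(x, y)] is the defect at [(x^n, y^n)]. *)
Lemma homogeneous_commuteM (R : realType) (G : groupType) (phi : G -> R) x y :
  quasi_homomorphism phi -> homogeneous phi -> commute x y ->
  phi (x * y)%g = phi x + phi y.
Proof.
move=> [D phi_quasi] phi_homog xyC; apply/eqP.
rewrite -subr_eq0 opprD addrA; apply/eqP.
apply: (@bounded_multiples_eq0 _ _ D) => n _.
by rewrite !mulrBr -!homogeneousX // expgMn.
Qed.

(** A quasi-homomorphism changes by at most [2 D] under conjugation, and
    conjugating commutes with taking powers. *)
Lemma homogeneous_conj (R : realType) (G : groupType) (phi : G -> R) g x :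
  quasi_homomorphism phi -> homogeneous phi ->
  phi (g * x * g^-1)%g = phi x.
Proof.
move=> [D phi_quasi] phi_homog; apply/eqP; rewrite -subr_eq0; apply/eqP.
apply: (@bounded_multiples_eq0 _ _ (D + D)) => n _.
have conjX : ((g * x * g^-1) ^+ n = g * x ^+ n * g^-1)%g.
  elim: n => [|n IHn]; first by rewrite !expg0 mulg1 mulgV.
  by rewrite !expgS IHn !mulgA mulgVK.
rewrite mulrBr -!homogeneousX // conjX.
(* Compare the defects at the two factorizations g * x^n and
   (g x^n g^-1) * g of the same element. *)
have := phi_quasi (g * x ^+ n * g^-1)%g g; rewrite mulgVK => le1.
apply: le_trans (lerD (phi_quasi g (x ^+ n)%g) le1).
apply: le_trans (ler_normB _ _).
rewrite [leRHS](_ : _ = `|phi (g * x ^+ n * g^-1)%g - phi (x ^+ n)%g|) //.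
by congr `|_|; ring.
Qed.

(** Moving [y i] to the right past the later [x j] only uses commutation for
    distinct indices; [x i] and [y i] need not commute. *)
Lemma prodgM_commute_neq (G : groupType) (I : eqType) (s : seq I)
    (x y : I -> G) :
  uniq s -> (forall i j, i != j -> commute (y i) (x j)) ->
  (\prod_(i <- s) (x i * y i) = \prod_(i <- s) x i * \prod_(i <- s) y i)%g.
Proof.
move=> s_uniq yxC; elim: s s_uniq => [|i s IHs] /=.
  by rewrite !big_nil mulg1.
case/andP=> i_notin /IHs prodE; rewrite !big_cons prodE !mulgA.
congr (_ * _)%g; rewrite -!mulgA; congr (_ * _)%g.
rewrite big_seq; apply: commute_prod => j j_in; apply: yxC.
by apply: contraNneq i_notin => ->.
Qed.

Lemma homogeneous_prod (R : realType) (G : groupType) (phi : G -> R)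
    (I : eqType) (s : seq I) (x : I -> G) :
  quasi_homomorphism phi -> homogeneous phi -> uniq s ->
  (forall i j, i != j -> commute (x i) (x j)) ->
  phi (\prod_(i <- s) x i)%g = \sum_(i <- s) phi (x i).
Proof.
move=> phi_quasi phi_homog s_uniq xC; elim: s s_uniq => [|i s IHs] /=.
  by rewrite !big_nil homogeneous1.
case/andP=> i_notin /IHs sumE; rewrite !big_cons -sumE.
apply: homogeneous_commuteM => //.
rewrite big_seq; apply: commute_prod => j j_in; apply: xC.
by apply: contraNneq i_notin => ->.
Qed.

Theorem proposition2p2 (R : realType) (G : groupType) (L : set G)
  (L_subgroup : group_closed (mem L))
  (L_conj : forall n : nat, (0 < n)%N -> has_commuting_conjugates L n)
  (phi : G -> R) (phi_quasi : quasi_homomorphism phi)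
  (phi_homog : homogeneous phi) :
  {in L &, {morph phi : x y / (x * y)%g >-> x + y}}.
Proof.
move=> x y /set_mem Lx /set_mem Ly /=; apply/eqP.
rewrite -subr_eq0 opprD addrA; apply/eqP.
have [D phi_bound] := phi_quasi.
apply: (@bounded_multiples_eq0 _ _ D) => n /L_conj[g gC].
have conjC (u v : G) : L u -> L v -> forall i j : 'I_n, i != j ->
    commute (g i * u * (g i)^-1)%g (g j * v * (g j)^-1)%g.
  by move=> Lu Lv i j /gC; apply; [exists u | exists v].
have prod_conj u : L u ->
    phi (\prod_(i < n) (g i * u * (g i)^-1))%g = n%:R * phi u.
  move=> Lu; rewrite homogeneous_prod ?index_enum_uniq //; last exact: conjC.
  under eq_bigr do rewrite homogeneous_conj //.
  by rewrite sumr_const card_ord mulr_natl.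
have Lxy : L (x * y)%g.
  by apply/set_mem/(group_closedM L_subgroup); apply/mem_set.
rewrite !mulrBr -!prod_conj //.
have -> : (\prod_(i < n) (g i * (x * y) * (g i)^-1) =
    \prod_(i < n) (g i * x * (g i)^-1) * \prod_(i < n) (g i * y * (g i)^-1))%g.
  rewrite -prodgM_commute_neq ?index_enum_uniq //; last exact: conjC.
  by apply: eq_bigr => i _; rewrite !mulgA mulgVK.
exact: phi_bound.
Qed.
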